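(* For $n\geqslant0$ let $B_n(x,y,s,t,p,1)=\sum_{\sigma\in\mathcal{S}^B_n}x^{\mathrm{exc}(\sigma)}y^{\mathrm{aexc}(\sigma)}s^{\mathrm{single}(\sigma)}t^{\mathrm{fix}(\sigma)}p^{\mathrm{neg}(\sigma)}$ (with $B_0=1$), and for $m\geqslant2$ let $\Phi_m(x,y)=xy\frac{x^{m-1}-y^{m-1}}{x-y}=xy(x^{m-2}+x^{m-3}y+\cdots+y^{m-2})$. Then for $n\geqslant2$, $$B_n(x,y,s,t,p,1)=(t+sp)^n+\sum_{k=0}^{n-2}\binom nk B_k(x,y,s,t,p,1)\,\Phi_{n-k}(x,y)(1+p)^{n-k}.$$
   Context: $\mathcal{S}^B_n$ is the group of bijections $\sigma$ of $\{\pm1,\dots,\pm n\}$ with $\sigma(-i)=-\sigma(i)$. For $i\in[n]$: $i$ is an excedance if $\sigma(|\sigma(i)|)>\sigma(i)$, an anti-excedance if $\sigma(|\sigma(i)|)<\sigma(i)$, a fixed point if $\sigma(i)=i$, a singleton if $\sigma(i)=-i$; $\mathrm{exc},\mathrm{aexc},\mathrm{fix},\mathrm{single}$ count these, and $\mathrm{neg}(\sigma)=\#\{i:\sigma(i)<0\}$. *)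

(* Defs.v *)
From HB Require Import structures.
From mathcomp Require Import all_boot all_order all_algebra all_fingroup.

Set Implicit Arguments.
Unset Strict Implicit.
Unset Printing Implicit Defensive.

Import Order.TTheory GRing.Theory Num.Theory.
Local Open Scope ring_scope.

(* The set {-n, ..., -1, 1, ..., n}. The pair (i, b) encodes the integer      *)
(* (-1)^b * (i + 1), see [ptZ], [ptZ_inj] and [ptZP]; in particular the index *)
(* i : 'I_n stands for i + 1 in [n].                                          *)
Definition signed_pt (n : nat) : finType := ('I_n * bool)%type.

Definition ptZ n (v : signed_pt n) : int :=
  if v.2 then - (v.1.+1)%:Z else (v.1.+1)%:Z.

Definition pos_pt n (i : 'I_n) : signed_pt n := (i, false).

Definition opp_pt n (v : signed_pt n) : signed_pt n := (v.1, ~~ v.2).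

Definition abs_pt n (v : signed_pt n) : signed_pt n := pos_pt v.1.

Lemma ptZ_inj n : injective (@ptZ n).
Proof.
case=> i [] [j []]; rewrite /ptZ //=.
  by move=> /oppr_inj [] /ord_inj ->.
by move=> [] /ord_inj ->.
Qed.

Lemma ptZP n (z : int) :
  (exists v : signed_pt n, ptZ v = z) <-> 1 <= `|z| <= n%:Z.
Proof.
split=> [[[i b] <-]|].
  by case: b; rewrite /ptZ /= ?normrN !lez_nat ltn_ord.
case: z => [[|m]|m] //= mn.
  by exists (Ordinal (mn : (m < n)%N), false).
by exists (Ordinal (mn : (m < n)%N), true).
Qed.

Lemma ptZ_opp n (v : signed_pt n) : ptZ (opp_pt v) = - ptZ v.
Proof. by case: v => i []; rewrite /ptZ /= ?opprK. Qed.

Lemma ptZ_abs n (v : signed_pt n) : ptZ (abs_pt v) = `|ptZ v|.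
Proof. by case: v => i []; rewrite /ptZ /= ?normrN. Qed.

Definition signed_perms (n : nat) : {set {perm signed_pt n}} :=
  [set sigma : {perm signed_pt n} |
    [forall v, sigma (opp_pt v) == opp_pt (sigma v)]].

Section Statistics.
Variables (n : nat) (sigma : {perm signed_pt n}).

Definition is_exc (i : 'I_n) : bool :=
  ptZ (sigma (abs_pt (sigma (pos_pt i)))) > ptZ (sigma (pos_pt i)).

Definition is_aexc (i : 'I_n) : bool :=
  ptZ (sigma (abs_pt (sigma (pos_pt i)))) < ptZ (sigma (pos_pt i)).

Definition exc : nat := #|[set i | is_exc i]|.

Definition aexc : nat := #|[set i | is_aexc i]|.

Definition fix_count : nat := #|[set i | sigma (pos_pt i) == pos_pt i]|.

Definition single : nat :=
  #|[set i | sigma (pos_pt i) == opp_pt (pos_pt i)]|.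

Definition neg : nat := #|[set i | ptZ (sigma (pos_pt i)) < 0]|.

End Statistics.

Definition Bpoly (R : comNzRingType) (n : nat) (x y s t p : R) : R :=
  \sum_(sigma in signed_perms n)
    x ^+ exc sigma * y ^+ aexc sigma * s ^+ single sigma *
    t ^+ fix_count sigma * p ^+ neg sigma.

Lemma Bpoly0 (R : comNzRingType) (x y s t p : R) : Bpoly 0 x y s t p = 1.
Proof.
have card0 (A : {set 'I_0}) : #|A| = 0%N by apply: eq_card0 => -[].
have only1 (sigma : {perm signed_pt 0}) : sigma = 1%g.
  by apply/permP => -[[]].
rewrite /Bpoly (big_pred1 1%g) => [|sigma].
  by rewrite /exc /aexc /single /fix_count /neg !card0 !expr0 !mulr1.
by rewrite (only1 sigma) /= eqxx inE; apply/forallP => -[[]].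
Qed.

(* The expanded form makes sense for all x and y in a commutative ring;       *)
(* [PhiE] relates it to the quotient by x - y.                                *)
Definition Phi (R : comNzRingType) (m : nat) (x y : R) : R :=
  x * y * \sum_(0 <= j < m.-1) x ^+ (m - 2 - j) * y ^+ j.

Lemma PhiE (R : comNzRingType) (m : nat) (x y : R) : (2 <= m)%N ->
  (x - y) * Phi m x y = x * y * (x ^+ (m - 1) - y ^+ (m - 1)).
Proof.
case: m => [|[|m]] // _; rewrite /Phi subn1 /= subrXX mulrCA big_mkord.
congr (_ * (_ * _)); apply: eq_bigr => j _.
by rewrite !subSS !subn0.
Qed.

(* Main.v *)
Require Import Defs.
From mathcomp Require Import all_boot all_order all_algebra all_fingroup.
From mathcomp Require Import ring.

(* Attach the sign of [sigma i] to the point [|sigma i|]: an element of the   *)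
(* hyperoctahedral group becomes a permutation [pi] together with a labelling *)
(* of the points by signed values, and excedances become ascents              *)
(* [label i < label (pi i)]. The new point n + 1 carries an extreme label, so *)
(* inserting it into the arc out of [i] always replaces the weight of that    *)
(* arc by xy(1 + p) times its sign weight. After shifting x, y, s, t by an    *)
(* indeterminate h, summing over the arcs is differentiation in h:            *)
(*   B_(n+1) = (t + sp) B_n + (1 + p) xy B_n'.                                *)
(* With q = 1 + p, the elements c_0 = -1 and c_m = Phi_m q^m satisfy          *)
(*   c_(m+1) = q xy c_m' - m q^2 xy c_(m-1),                                  *)
(* and so S_n = sum_k 'C(n, k) B_k c_(n-k) satisfies                          *)
(*   S_(n+1) = (t + sp) S_n + q xy S_n' - n q^2 xy S_(n-1),                   *)
(* which is also the recurrence of - (t + sp)^n. Put h = 0 in the end.        *)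

Set Implicit Arguments.
Unset Strict Implicit.
Unset Printing Implicit Defensive.

Import Order.TTheory GRing.Theory Num.Theory.
Local Open Scope ring_scope.

(** The theorem says S_n = - (t + sp)^n: in S_n the term k = n is - B_n, the term k = n - 1 vanishes
    with Phi_1, and the others form the stated sum. The recurrence of B_n rests on [Bpoly_arc_wt]
    and [BpolyS_insert], that of c_m on [deriv_Phi]; [binom_conv_cycle] joins them. *)

(** * Signed permutations as permutations with signed points *)

Section SignedPerm.
Variable n : nat.
Implicit Type u : ('S_n * {ffun 'I_n -> bool})%type.

Let signed_fun u (v : signed_pt n) : signed_pt n :=
  (u.1 v.1, u.2 (u.1 v.1) (+) v.2).

Lemma signed_fun_inj u : injective (signed_fun u).
Proof. by case=> i b [j c] [] /perm_inj <- /addbI <-. Qed.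

Definition signed_perm_of u : {perm signed_pt n} := perm (@signed_fun_inj u).

Lemma signed_perm_ofE u i b :
  signed_perm_of u (i, b) = (u.1 i, u.2 (u.1 i) (+) b).
Proof. by rewrite permE. Qed.

Lemma signed_perm_of_inj : injective signed_perm_of.
Proof.
case=> pi e [pi' e'] eq_u.
have eq_at i : (pi i, e (pi i)) = (pi' i, e' (pi' i)).
  by have /permP/(_ (i, false)) := eq_u; rewrite !signed_perm_ofE /= !addbF.
have eq_pi : pi = pi' by apply/permP=> i; case: (eq_at i).
congr (_, _) => //; apply/ffunP=> k.
by have := eq_at ((pi^-1)%g k); rewrite -eq_pi permKV => -[].
Qed.

Lemma signed_permsE : signed_perms n = signed_perm_of @: setT.
Proof.
apply/setP=> sigma; rewrite inE.
  apply/forallP/imsetP=> [sigma_opp | [u _ ->] [i b]].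
  have {}sigma_opp i b : sigma (i, b) =
      ((sigma (i, false)).1, (sigma (i, false)).2 (+) b).
    case: b; last by rewrite addbF -surjective_pairing.
    by have /eqP := sigma_opp (i, false); rewrite /opp_pt /= addbT.
  have abs_inj : injective (fun i => (sigma (i, false)).1).
    move=> i j eq_ij.
    have : sigma (i, (sigma (i, false)).2) = sigma (j, (sigma (j, false)).2).
      by rewrite !(sigma_opp _ (_.2)) !addbb eq_ij.
    by move=> /perm_inj [].
  (* If [sigma] sends [(i, false)] to [(k, c)], it sends [(i, c)] to [(k, false)]; so the preimage
     of the positive point k carries the sign of k. *)
  exists (perm abs_inj, [ffun k => ((sigma^-1)%g (k, false)).2]) => //.
  apply/permP=> -[i b]; rewrite signed_perm_ofE /= ffunE permE sigma_opp.
  congr (_, _ (+) _).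
  have -> : ((sigma (i, false)).1, false) = sigma (i, (sigma (i, false)).2).
    by rewrite sigma_opp addbb.
  by rewrite permK.
by apply/eqP; rewrite /opp_pt !signed_perm_ofE /= addbN.
Qed.

End SignedPerm.

Definition arc_wt (R : comNzRingType) (x y s t p : R) n (e : 'I_n -> bool)
    (pi : 'S_n) (i : 'I_n) : R :=
  (if pi i == i then if e i then s else t
   else if ptZ (i, e i) < ptZ (pi i, e (pi i)) then x else y) *
  (if e i then p else 1).

Lemma expr_card_set (R : comNzRingType) (T : finType) (P : pred T) (z : R) :
  z ^+ #|[set i | P i]| = \prod_i (if P i then z else 1).
Proof.
by rewrite -big_mkcond /= -prodr_const; apply: eq_bigl => i; rewrite inE.
Qed.

(* In [arc_wt] the sign is attached to the point rather than to its preimage, *)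
(* so the statistics of [sigma] at [i] are read at the point [|sigma i|].     *)
Lemma Bpoly_arc_wt (R : comNzRingType) n (x y s t p : R) :
  Bpoly n x y s t p =
    \sum_(e : {ffun 'I_n -> bool}) \sum_(pi : 'S_n)
      \prod_i arc_wt x y s t p e pi i.
Proof.
rewrite /Bpoly signed_permsE big_imset /=; last first.
  by move=> u v _ _; apply: signed_perm_of_inj.
rewrite exchange_big pair_bigA /=.
apply: eq_big => [u|[pi e] _]; first by rewrite inE.
rewrite !expr_card_set -!big_split /= [RHS](reindex_perm pi) /=.
apply: eq_bigr => i _.
rewrite /is_exc /is_aexc /arc_wt /abs_pt /opp_pt /pos_pt.
rewrite !signed_perm_ofE /= !addbF.
have ptZ_lt0 : (ptZ (pi i, e (pi i)) < 0) = e (pi i).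
  by rewrite /ptZ /=; case: (e (pi i)).
rewrite ptZ_lt0 !xpair_eqE (inj_eq perm_inj); case: eqP => [pii|/eqP pii] /=.
  by rewrite !pii ltxx; case: (e i) => /=; rewrite ?mulr1 ?mul1r.
rewrite !mulr1; case: ltgtP => [_|_|/ptZ_inj []]; rewrite ?mulr1 ?mul1r //.
by move=> /perm_inj pii'; rewrite -pii' eqxx in pii.
Qed.

(** * Inserting a new largest point *)

Section Insertion.
Variables (R : comNzRingType) (x y s t p : R) (n : nat).

(** Products act from left to right: [u.1] goes to the new point, which takes over the former image
    of [u.1], or is fixed if [u.1] is [ord_max]. *)
Definition insert_max (u : 'I_n.+1 * 'S_n) : 'S_n.+1 :=
  (tperm u.1 ord_max * lift_perm ord_max ord_max u.2)%g.

Lemma insert_max_bij : bijective insert_max.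
Proof.
apply: inj_card_bij; last by rewrite card_prod card_ord !card_Sn factS.
have at_j u : insert_max u u.1 = ord_max.
  by rewrite /insert_max permM tpermL lift_perm_id.
case=> j pi [j' pi'] eq_u.
have eq_j : j = j'.
  have := at_j (j', pi'); rewrite -eq_u -[RHS](at_j (j, pi)) /=.
  by move/perm_inj.
move: eq_u; rewrite -eq_j => /mulgI eq_lift; congr (_, _).
apply/permP=> i; have /permP/(_ (lift ord_max i)) := eq_lift.
by rewrite !lift_perm_lift => /lift_inj.
Qed.

Lemma ptZ_lift_max (i : 'I_n) b : ptZ (lift ord_max i, b) = ptZ (i, b).
Proof. by rewrite /ptZ lift_max. Qed.

Lemma ptZ_max_lt (i : 'I_n) b c :
  (ptZ ((ord_max : 'I_n.+1), b) < ptZ (lift ord_max i, c)) = b.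
Proof.
rewrite ptZ_lift_max /ptZ /=.
by case: b c => -[]; rewrite ?ltrN2 ?ltz_nat ?ltnS ?ltn_ord // ltnNge ltnW.
Qed.

Lemma ptZ_lt_max (i : 'I_n) b c :
  (ptZ (lift ord_max i, c) < ptZ ((ord_max : 'I_n.+1), b)) = ~~ b.
Proof.
rewrite ptZ_lift_max /ptZ /=.
by case: b c => -[]; rewrite ?ltrN2 ?ltz_nat ?ltnS ?ltn_ord // ltnNge ltnW.
Qed.

Let wt := arc_wt x y s t p.

Lemma prod_insert_max_fixed (e : 'I_n.+1 -> bool) (pi : 'S_n) :
  \prod_i wt e (insert_max (ord_max, pi)) i =
  (if e ord_max then s * p else t) *
  \prod_i wt (e \o lift ord_max) pi i.
Proof.
rewrite (bigD1_ord ord_max) //=; congr (_ * _).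
  rewrite /wt /arc_wt /insert_max /= tperm1 mul1g lift_perm_id eqxx.
  by case: (e _); rewrite ?mulr1.
apply: eq_bigr => i _.
rewrite /wt /arc_wt /insert_max /= tperm1 mul1g lift_perm_lift.
by rewrite (inj_eq lift_inj) !ptZ_lift_max.
Qed.

(** The label of the new point is the largest or the smallest, so exactly one of the arcs into and
    out of it is an ascent: together they give xy, whatever the arc of [j] weighed, even a loop.
    Only the sign weight of [j] survives. *)
Lemma prod_insert_max_arc (e : 'I_n.+1 -> bool) (pi : 'S_n) (j : 'I_n) :
  \prod_i wt e (insert_max (lift ord_max j, pi)) i =
  x * y * (if e ord_max then p else 1) *
  ((if e (lift ord_max j) then p else 1) *
   \prod_(i | i != j) wt (e \o lift ord_max) pi i).
Proof.
rewrite (bigD1_ord ord_max) //= (bigD1 j) //=.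
have -> : \prod_(i < n | i != j)
     wt e (insert_max (lift ord_max j, pi)) (lift ord_max i) =
     \prod_(i < n | i != j) wt (e \o lift ord_max) pi i.
  apply: eq_bigr => i ij; rewrite /wt /arc_wt /insert_max /= permM tpermD.
  - by rewrite lift_perm_lift (inj_eq lift_inj) !ptZ_lift_max.
  - by rewrite (inj_eq lift_inj) eq_sym.
  - exact: neq_lift.
rewrite /wt /arc_wt /insert_max /= !permM tpermR tpermL lift_perm_lift.
rewrite lift_perm_id (negbTE (neq_lift _ _)) eq_sym (negbTE (neq_lift _ _)).
rewrite ptZ_lt_max ptZ_max_lt.
by case: (e ord_max); case: (e (lift _ _)) => /=; ring.
Qed.

Definition extend_max (u : bool * {ffun 'I_n -> bool}) :
    {ffun 'I_n.+1 -> bool} :=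
  [ffun i => if unlift ord_max i is Some j then u.2 j else u.1].

Lemma extend_max_bij : bijective extend_max.
Proof.
exists (fun e : {ffun 'I_n.+1 -> bool} =>
          (e ord_max, [ffun j => e (lift ord_max j)])) => [[b e]|e].
  congr (_, _); first by rewrite ffunE unlift_none.
  by apply/ffunP=> j; rewrite !ffunE liftK.
apply/ffunP=> i; rewrite ffunE.
by case: unliftP => [j ->|->] //=; rewrite ffunE.
Qed.

Lemma BpolyS_insert :
  Bpoly n.+1 x y s t p =
  (t + s * p) * Bpoly n x y s t p +
  (1 + p) * (x * y) *
    \sum_(e : {ffun 'I_n -> bool}) \sum_(pi : 'S_n) \sum_j
      (if e j then p else 1) * \prod_(i | i != j) arc_wt x y s t p e pi i.
Proof.
rewrite !Bpoly_arc_wt (reindex _ (onW_bij _ extend_max_bij)) /=.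
rewrite -(pair_bigA _ (fun b e => \sum_(pi : 'S_n.+1)
   \prod_i wt (extend_max (b, e)) pi i)) /=.
have sum_b b : \sum_(e : {ffun 'I_n -> bool}) \sum_(pi : 'S_n.+1)
     \prod_i wt (extend_max (b, e)) pi i =
  (if b then s * p else t) *
    (\sum_(e : {ffun 'I_n -> bool}) \sum_(pi : 'S_n) \prod_i wt e pi i) +
  (if b then p else 1) * (x * y) *
    \sum_(e : {ffun 'I_n -> bool}) \sum_(pi : 'S_n) \sum_j
      (if e j then p else 1) * \prod_(i | i != j) wt e pi i.
  rewrite !mulr_sumr -big_split; apply: eq_bigr => e _ /=.
  rewrite (reindex _ (onW_bij _ insert_max_bij)) /=.
  rewrite -(pair_bigA _ (fun j pi =>
     \prod_i wt (extend_max (b, e)) (insert_max (j, pi)) i)) /=.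
  have e_max : extend_max (b, e) ord_max = b by rewrite ffunE unlift_none.
  have e_lift j : extend_max (b, e) (lift ord_max j) = e j.
    by rewrite ffunE liftK.
  have wt_e pi i : wt (extend_max (b, e) \o lift ord_max) pi i = wt e pi i.
    by rewrite /wt /arc_wt /= !e_lift.
  rewrite (bigD1_ord ord_max) //= !mulr_sumr exchange_big /=; congr (_ + _).
    apply: eq_bigr => pi _; rewrite prod_insert_max_fixed e_max.
    by congr (_ * _); apply: eq_bigr => i _.
  apply: eq_bigr => pi _; rewrite mulr_sumr; apply: eq_bigr => j _.
  rewrite prod_insert_max_arc e_max e_lift [x * y * _]mulrC.
  by congr (_ * (_ * _)); apply: eq_bigr => i _.
rewrite big_bool /= !sum_b; rewrite /wt; ring.
Qed.

End Insertion.

Lemma rmorph_Bpoly (A R : comNzRingType) (f : {rmorphism A -> R}) n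
    (x y s t p : A) :
  f (Bpoly n x y s t p) = Bpoly n (f x) (f y) (f s) (f t) (f p).
Proof.
by rewrite rmorph_sum; apply: eq_bigr => sigma _; rewrite !rmorphM !rmorphXn.
Qed.

Lemma rmorph_Phi (A R : comNzRingType) (f : {rmorphism A -> R}) m (x y : A) :
  f (Phi m x y) = Phi m (f x) (f y).
Proof.
rewrite /Phi !rmorphM rmorph_sum; congr (_ * _).
by apply: eq_bigr => j _; rewrite rmorphM !rmorphXn.
Qed.

Lemma deriv_prod (R : comNzRingType) n (F : 'I_n -> {poly R}) :
  (\prod_i F i)^`() = \sum_i (F i)^`() * \prod_(j | j != i) F j.
Proof.
elim: n F => [|n IHn] F; first by rewrite !big_ord0 derivC.
rewrite !big_ord_recl derivM IHn mulr_sumr; congr (_ * _ + _).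
  by rewrite [RHS]big_mkcond big_ord_recl eqxx /= mul1r.
apply: eq_bigr => i _; rewrite mulrCA; congr (_ * _).
rewrite [RHS]big_mkcond big_ord_recl /= [in LHS]big_mkcond; congr (_ * _).
Qed.

(** * Phi through complete homogeneous symmetric polynomials *)

Section CompleteHomogeneous.
Variable R : comNzRingType.

Definition hsym (k : nat) (x y : R) : R :=
  \sum_(j < k.+1) x ^+ (k - j) * y ^+ j.

Lemma Phi_hsym k x y : Phi k.+2 x y = x * y * hsym k x y.
Proof.
rewrite /Phi big_mkord; congr (_ * _); apply: eq_bigr => j _.
by rewrite !subSS subn0.
Qed.

Lemma hsym0 x y : hsym 0 x y = 1.
Proof. by rewrite /hsym big_ord1 mulr1. Qed.

Lemma hsymS k x y : hsym k.+1 x y = x * hsym k x y + y ^+ k.+1.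
Proof.
rewrite /hsym big_ord_recr /= subnn mul1r mulr_sumr; congr (_ + _).
by apply: eq_bigr => j _; rewrite mulrA -exprS subSn // -ltnS.
Qed.

Lemma hsymSS k x y :
  hsym k.+2 x y = (x + y) * hsym k.+1 x y - x * y * hsym k x y.
Proof.
rewrite hsymS (hsymS k) [y ^+ k.+2]exprS.
by move: (hsym k x y) (y ^+ k.+1) => h z; ring.
Qed.

End CompleteHomogeneous.

Section UnitDerivative.
Variables (R : comNzRingType) (x y s t p : {poly R}).
Hypotheses (x' : x^`() = 1) (y' : y^`() = 1).

(** Formally, h_(k+1) = (x^(k+2) - y^(k+2)) / (x - y), and x - y has derivative 0. The induction
    avoids the division. *)
Lemma deriv_hsym k : (hsym k.+1 x y)^`() = k.+2%:R * hsym k x y.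
Proof.
elim: k => [|k IHk].
  by rewrite hsymS !hsym0 mulr1 expr1 derivD x' y' mulr1.
rewrite hsymS derivD derivM IHk deriv_exp x' y' /= !mul1r.
rewrite -[y ^+ k.+1 *+ _]mulr_natl (hsymS k) -[k.+3%:R]natr1.
by move: (hsym k x y) (y ^+ k.+1) k.+2%:R => h z c; ring.
Qed.

(** As (xy)' = x + y, [hsymSS] applies; its correction term raises the factor m + 1 from
    [deriv_hsym] to m + 2. *)
Lemma deriv_Phi m :
  x * y * (Phi m.+2 x y)^`() =
  Phi m.+3 x y + m.+2%:R * (x * y) * Phi m.+1 x y.
Proof.
case: m => [|m].
  rewrite !Phi_hsym /Phi /= big_nil !mulr0 addr0 hsymS !hsym0 !mulr1.
  by rewrite derivM x' y' mul1r mulr1 [y + x]addrC.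
rewrite !Phi_hsym !derivM deriv_hsym x' y' hsymSS -!natr1; ring.
Qed.

Hypotheses (s' : s^`() = 1) (t' : t^`() = 1) (p' : p^`() = 0).

(** The first factor of every arc weight has derivative 1 and the sign weight is constant, so the
    sum over [j] in [BpolyS_insert] is the product rule. *)
Lemma BpolyS n :
  Bpoly n.+1 x y s t p =
  (t + s * p) * Bpoly n x y s t p +
  (1 + p) * (x * y) * (Bpoly n x y s t p)^`().
Proof.
rewrite BpolyS_insert; congr (_ + _ * _).
rewrite Bpoly_arc_wt raddf_sum; apply: eq_bigr => e _.
rewrite raddf_sum; apply: eq_bigr => pi _ /=; rewrite deriv_prod.
apply: eq_bigr => j _; congr (_ * _).
rewrite /arc_wt derivM.
have -> : (if e j then p else 1)^`() = 0 by case: (e j); rewrite ?derivC.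
rewrite mulr0 addr0 -[LHS]mul1r; congr (_ * _).
by case: ifP => _; case: ifP.
Qed.

End UnitDerivative.

(** * Binomial convolution, the product of exponential generating functions *)

Definition binom_conv (R : comNzRingType) (f g : nat -> R) (n : nat) : R :=
  \sum_(k < n.+1) 'C(n, k)%:R * f k * g (n - k)%N.

(** The product rule for generating functions, by Pascal's rule. *)
Lemma binom_convS (R : comNzRingType) (f g : nat -> R) n :
  binom_conv f g n.+1 =
  binom_conv (f \o succn) g n + binom_conv f (g \o succn) n.
Proof.
rewrite /binom_conv big_ord_recl /= bin0 subn0.
under eq_bigr => i _ do rewrite /= /bump add1n binS natrD !mulrDl subSS.
rewrite big_split /= addrA addrC; congr (_ + _).
rewrite big_ord_recr /= bin_small // !mul0r addr0.
rewrite [RHS]big_ord_recl /= bin0 subn0.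
congr (_ + _); apply: eq_bigr => i _.
by rewrite /bump add1n subnSK.
Qed.

(** Passing to m g_(m-1) multiplies the generating function by its variable. *)
Lemma binom_conv_lower (R : comNzRingType) (f g : nat -> R) n :
  binom_conv f (fun m => m%:R * g m.-1) n.+1 = n.+1%:R * binom_conv f g n.
Proof.
rewrite /binom_conv big_ord_recr /= subnn mul0r mulr0 addr0 mulr_sumr.
apply: eq_bigr => k _.
have -> : (n.+1 - k).-1 = (n - k)%N by rewrite subSn // -ltnS.
have : n.+1%:R * 'C(n, k)%:R = (n.+1 - k)%:R * 'C(n.+1, k)%:R :> R.
  by rewrite -!natrM mul_bin_down.
by rewrite !mulrA => ->; ring.
Qed.

Lemma deriv_binom_conv (R : comNzRingType) (f g : nat -> {poly R}) n :
  (binom_conv f g n)^`() =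
  binom_conv (fun k => (f k)^`()) g n + binom_conv f (fun k => (g k)^`()) n.
Proof.
rewrite /binom_conv raddf_sum -big_split; apply: eq_bigr => k _ /=.
by rewrite !derivM derivMn derivC mul0rn mul0r add0r.
Qed.

(* The value [-1] at [0] makes the recurrence [cycle_coefS] hold from [m = 0] *)
(* and turns the theorem into a convolution identity.                         *)
Definition cycle_coef (R : comNzRingType) (x y p : R) (m : nat) : R :=
  if m is 0 then -1 else Phi m x y * (1 + p) ^+ m.

Lemma rmorph_cycle_coef (A R : comNzRingType) (f : {rmorphism A -> R})
    (x y p : A) m :
  f (cycle_coef x y p m) = cycle_coef (f x) (f y) (f p) m.
Proof.
case: m => [|m]; first by rewrite rmorphN1.
by rewrite rmorphM rmorph_Phi rmorphXn rmorphD rmorph1.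
Qed.

Section Convolution.
Variables (R : comNzRingType) (x y s t p : {poly R}).
Hypotheses (x' : x^`() = 1) (y' : y^`() = 1).
Hypotheses (s' : s^`() = 1) (t' : t^`() = 1).
Hypothesis p' : p^`() = 0.

Let b n := Bpoly n x y s t p.
Let c := cycle_coef x y p.
Let a := t + s * p.
Let q := 1 + p.

Let q' : q^`() = 0.
Proof. by rewrite derivD derivC p' addr0. Qed.

Let a' : a^`() = q.
Proof. by rewrite derivD derivM s' t' p' mul1r mulr0 addr0. Qed.

Lemma cycle_coefS m :
  c m.+1 = q * (x * y) * (c m)^`() - q ^+ 2 * (x * y) * (m%:R * c m.-1).
Proof.
case: m => [|[|m]].
- by rewrite /c /= derivN derivC /Phi big_nil; ring.
(* Here c_1 = 0, so c_2 = q^2 xy comes entirely from c_0 = -1. *)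
- rewrite /c /= Phi_hsym hsym0 /Phi big_nil !mulr0 mul0r derivC -/q; ring.
- rewrite /c /cycle_coef derivM deriv_exp q' mul0r mul0rn mulr0 addr0 -/q /=.
  have -> : q * (x * y) * ((Phi m.+2 x y)^`() * q ^+ m.+2) =
     (x * y * (Phi m.+2 x y)^`()) * q ^+ m.+3 by rewrite [q ^+ m.+3]exprS; ring.
  rewrite deriv_Phi // [q ^+ m.+3]exprS [q ^+ m.+2]exprS.
  by move: (q ^+ m.+1) (Phi m.+3 x y) (Phi m.+1 x y) m.+2%:R => ? ? ? ?; ring.
Qed.

Lemma binom_conv_cycleS n :
  binom_conv b c n.+1 =
  a * binom_conv b c n + q * (x * y) * (binom_conv b c n)^`() -
  q ^+ 2 * (x * y) * binom_conv b (fun m => m%:R * c m.-1) n.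
Proof.
rewrite binom_convS deriv_binom_conv /binom_conv !mulrDr !mulr_sumr.
rewrite -sumrN -!big_split; apply: eq_bigr => k _.
rewrite /comp {1}/b BpolyS // cycle_coefS -/a -/q -/(b k).
move: (b k) (b k)^`() (c (n - k)%N) (c (n - k)%N)^`() (c (n - k)%N.-1).
by move=> b0 b1 c0 c1 c2 /=; ring.
Qed.

(** Since a' = q, the derivative term and the lowering term of [binom_conv_cycleS] cancel, leaving
    multiplication by a. The recurrence reaches back two indices, hence the induction on pairs. *)
Lemma binom_conv_cycle n : binom_conv b c n = - a ^+ n.
Proof.
suff: binom_conv b c n = - a ^+ n /\ binom_conv b c n.+1 = - a ^+ n.+1 by case.
have conv0 : binom_conv b c 0 = -1.
  by rewrite /binom_conv big_ord1 /= /b Bpoly0 bin0 mul1r mul1r.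
elim: n => [|n [IHn IHn1]]; split=> //.
  rewrite binom_conv_cycleS conv0 derivN derivC /binom_conv big_ord1 /=.
  by rewrite mul0r !mulr0 oppr0 mulr0 !addr0 mulrN1 expr1.
rewrite binom_conv_cycleS binom_conv_lower IHn IHn1 derivN deriv_exp a' /=.
rewrite -mulr_natr [a ^+ n.+2]exprS.
by move: (a ^+ n) (a ^+ n.+1) n.+1%:R => ? ? ?; ring.
Qed.

End Convolution.

Theorem theorem28 (R : comNzRingType) (n : nat) (x y s t p : R)
    (hn : (2 <= n)%N) :
  Bpoly n x y s t p =
    (t + s * p) ^+ n +
    \sum_(0 <= k < n.-1)
      'C(n, k)%:R * Bpoly k x y s t p * Phi (n - k) x y * (1 + p) ^+ (n - k).
Proof.
(* The indeterminate gives x, y, s, t derivative 1 while p stays constant; evaluation at 0 recovers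
   the original values. *)
pose shift z : {poly R} := z%:P + 'X.
have shift' z : (shift z)^`() = 1 by rewrite derivD derivC derivX add0r.
pose f : {rmorphism {poly R} -> R} := horner_eval 0.
have shift0 z : f (shift z) = z.
  by rewrite /f /= horner_evalE hornerD hornerC hornerX addr0.
have polyC0 z : f z%:P = z by rewrite /f /= horner_evalE hornerC.
have := congr1 f (binom_conv_cycle (shift' x) (shift' y) (shift' s) (shift' t)
  (derivC p) n).
rewrite rmorphN rmorphXn rmorphD rmorphM !shift0 polyC0 /binom_conv rmorph_sum.
under eq_bigr => k _ do
  rewrite !rmorphM rmorph_nat rmorph_Bpoly rmorph_cycle_coef !shift0 polyC0.
(* The two split terms are the top ones: the last is - B_n, the one before it is 0. *)
case: n hn => [|[|n]] // _; rewrite big_ord_recr big_ord_recr /=.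
rewrite subnn subSnn /= /Phi big_nil mulr0 mul0r mulr0 addr0 binn mul1r mulrN1.
move=> conv; rewrite big_mkord -[(t + s * p) ^+ _]opprK -conv opprB.
rewrite -[LHS](subrK (\sum_(k < n.+1) 'C(n.+2, k)%:R * Bpoly k x y s t p *
  cycle_coef x y p (n.+2 - k))); congr (_ + _).
by apply: eq_bigr => k _; rewrite -[in RHS]mulrA subSn // ltnW.
Qed.
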